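(* Let $X$, $Y$ be Banach spaces, $G \subset X$ an open set and $f:G \to Y$ a continuous mapping. Let $V_1$ be a subspace of $X$ such that the space $\mathcal{L}(V_1,Y)$ is separable. Then there exists a first category set $A \subset G$ such that, for each $x \in G \setminus A$, the following assertion holds: if $f$ is Fréchet differentiable at $x$ along $V_1$ and along some topological complement $V_2^x$ of $V_1$, then $f$ is Fréchet differentiable at $x$.
   Context: All Banach spaces are real and nontrivial ($\neq\{0\}$). A subspace of a Banach space means a closed linear subspace $\neq\{0\}$. $\mathcal{L}(V_1,Y)$ is the Banach space of continuous linear mappings $V_1\to Y$ with the operator norm. A topological complement of $V_1$ in $X$ is a subspace $V_2$ such that $X$ is the topological direct sum $V_1\oplus V_2$. For a subspace $V$ of $X$, $f$ is Fréchet differentiable at $x\in G$ along $V$ if the mapping $g(v):=f(x+v)$, $v\in V\cap(G-x)$, is Fréchet differentiable at $0\in V$. A first category (meagre) set is a countable union of nowhere dense sets. *)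

(* Defs.v *)
From HB Require Import structures.
From mathcomp Require Import all_boot all_order all_algebra.
From mathcomp Require Import all_classical all_reals all_analysis.
Set Implicit Arguments.
Unset Strict Implicit.
Unset Printing Implicit Defensive.
Import Order.TTheory GRing.Theory Num.Theory.
Import numFieldNormedType.Exports.
Local Open Scope classical_set_scope.
Local Open Scope ring_scope.

Section Topology.
Context {T : topologicalType}.

Definition nowhere_dense (A : set T) := interior (closure A) = set0.

Definition first_category (A : set T) :=
  exists2 F : nat -> set T,
    (forall n, nowhere_dense (F n)) & A = \bigcup_n F n.

End Topology.

Definition separable_space (T : topologicalType) :=
  exists2 D : set T, countable D & dense D.

Section Subspace.
Context {R : realType} {X : normedModType R}.

Record closedSubspace := ClosedSubspace {
  subspace_pred :> {pred X};
  subspace_submod : submod_closed subspace_pred;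
  subspace_closed : closed [set` subspace_pred];
  subspace_neq0 : exists2 x, x \in subspace_pred & x != 0
}.

HB.instance Definition _ (V : closedSubspace) :=
  GRing.isSubmodClosed.Build R X (subspace_pred V) (subspace_submod V).

Definition subspace_sort (V : closedSubspace) : Type :=
  {x : X | x \in subspace_pred V}.

End Subspace.
Arguments closedSubspace {R} X.
Coercion subspace_sort : closedSubspace >-> Sortclass.

Section SubspaceNormed.
Context {R : realType} {X : normedModType R} (V : closedSubspace X).

HB.instance Definition _ := SubChoice.on (subspace_sort V).
HB.instance Definition _ :=
  [SubChoice_isSubLmodule of subspace_sort V by <:].

Let norm (v : V) : R := `|val v|.

Let norm_triangle u v : norm (u + v) <= norm u + norm v.
Proof. by rewrite /norm raddfD /= ler_normD. Qed.

Let norm_scale (a : R) v : norm (a *: v) = `|a| * norm v.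
Proof. by rewrite /norm linearZ /= normrZ. Qed.

Let norm_eq0 v : norm v = 0 -> v = 0.
Proof. by move=> /normr0_eq0 v0; apply: val_inj; rewrite v0 raddf0. Qed.

HB.instance Definition _ := @Lmodule_isNormed.Build R (subspace_sort V)
  norm norm_triangle norm_scale norm_eq0.

End SubspaceNormed.

(* The sum map being automatically continuous, this says that it is a linear
   homeomorphism from the product V1 * V2 onto X. *)
Definition topological_complement {R : realType} {X : normedModType R}
    (V1 V2 : closedSubspace X) :=
  exists g : X -> V1 * V2,
    [/\ cancel (fun u : V1 * V2 => val u.1 + val u.2) g,
        cancel g (fun u : V1 * V2 => val u.1 + val u.2) & continuous g].

(* A map defined on an open set G is represented by a total function.  For x in
   G, v ranges over a neighborhood V `&` (G - x) of 0 in V as far as the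
   differential at 0 is concerned, so the values of f outside G are irrelevant.
   V carries the norm induced by X. *)
Definition differentiable_along {R : realType} {X Y : normedModType R}
    (f : X -> Y) (x : X) (V : closedSubspace X) :=
  differentiable (fun v : V => f (x + val v)) (0 : V).

Section ContinuousLinear.
Context {R : realType} (V W : normedModType R).

Definition clinear_pred : {pred V -> W} :=
  fun f => `[< linear f /\ continuous f >].

Lemma clinear_submod : submod_closed clinear_pred.
Proof.
split=> [|a f g].
  apply/asboolP; split; last by move=> x; exact: cvg_cst.
  by move=> a x y; rewrite /GRing.zero /= scaler0 addr0.
move=> /asboolP[lf cf] /asboolP[lg cg]; apply/asboolP; split.
  move=> b x y.
  rewrite -[LHS]/(a *: f (b *: x + y) + g (b *: x + y)).
  rewrite -[RHS]/(b *: (a *: f x + g x) + (a *: f y + g y)).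
  by rewrite lf lg !scalerDr !scalerA [a * b]mulrC addrACA.
by move=> x; apply: cvgD (cg x); apply: cvgZl_tmp (cf x).
Qed.

HB.instance Definition _ :=
  GRing.isSubmodClosed.Build R (V -> W) clinear_pred clinear_submod.

Definition clinear : Type := {f : V -> W | f \in clinear_pred}.

HB.instance Definition _ := SubChoice.on clinear.
HB.instance Definition _ := [SubChoice_isSubLmodule of clinear by <:].

Definition opnorm (f : clinear) : R :=
  sup [set `|val f x| | x in [set x : V | `|x| <= 1]].

Let clinear_linear (f : clinear) : linear (val f).
Proof. by have /asboolP[] := valP f. Qed.

Let clinear0 (f : clinear) : val f 0 = 0.
Proof.
by have := clinear_linear f (-1) 0 0; rewrite scaler0 addr0 scaleN1r addNr.
Qed.

Let clinearZ (f : clinear) a x : val f (a *: x) = a *: val f x.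
Proof.
by have := clinear_linear f a x 0; rewrite addr0 clinear0 addr0.
Qed.

Lemma opnorm_has_sup (f : clinear) :
  has_sup [set `|val f x| | x in [set x : V | `|x| <= 1]].
Proof.
split; first by exists `|val f 0|, 0 => //=; rewrite normr0 ler01.
have /asboolP[_ /(_ 0)] := valP f.
rewrite /continuous_at clinear0 => /cvgr0Pnorm_lt/(_ 1 ltr01).
move=> /nbhs_norm0P[e /= e0 fe]; exists (2 / e) => _ [x /= x1 <-].
have e20 : 0 < e / 2 by rewrite divr_gt0.
have /fe : `|(e / 2) *: x| < e.
  rewrite normrZ gtr0_norm // (le_lt_trans (ler_piMr (ltW e20) x1)) //.
  by rewrite ltr_pdivrMr // mulr_natr mulr2n ltrDl.
rewrite clinearZ normrZ gtr0_norm // => /ltW.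
by rewrite -ler_pdivlMl // mulr1 invf_div.
Qed.

Lemma opnorm_ub (f : clinear) x : `|x| <= 1 -> `|val f x| <= opnorm f.
Proof.
by move=> x1; apply: sup_upper_bound (opnorm_has_sup f) _ _; exists x.
Qed.

Lemma opnorm_le (f : clinear) M :
  (forall x, `|x| <= 1 -> `|val f x| <= M) -> opnorm f <= M.
Proof.
move=> fM; apply: ge_sup; first by have [] := opnorm_has_sup f.
by move=> _ [x /= x1 <-]; exact: fM.
Qed.

Lemma ler_opnormD (f g : clinear) : opnorm (f + g) <= opnorm f + opnorm g.
Proof.
apply: opnorm_le => x x1; rewrite raddfD /=.
rewrite (le_trans (ler_normD _ _)) //.
by rewrite lerD // opnorm_ub.
Qed.

Let opnormZ_le a (f : clinear) : opnorm (a *: f) <= `|a| * opnorm f.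
Proof.
apply: opnorm_le => x x1; rewrite linearZ /=.
rewrite -[X in `|X|]/(a *: val f x) normrZ.
by rewrite ler_wpM2l // opnorm_ub.
Qed.

Lemma opnorm_eq0 (f : clinear) : opnorm f = 0 -> f = 0.
Proof.
move=> f0; apply: val_inj; apply/funext => x.
rewrite raddf0 -[RHS]/(0 : W).
have [->|x0] := eqVneq x 0; first exact: clinear0.
have : `|val f (`|x|^-1 *: x)| <= 0.
  by rewrite -f0; apply: opnorm_ub; rewrite normfZV.
rewrite clinearZ normrZ pmulr_rle0; last by rewrite normr_gt0 invr_eq0 normr_eq0.
by rewrite normr_le0 => /eqP.
Qed.

Lemma opnormZ a (f : clinear) : opnorm (a *: f) = `|a| * opnorm f.
Proof.
have [->|a0] := eqVneq a 0.
  rewrite scale0r normr0 mul0r; apply/eqP; rewrite eq_le; apply/andP; split.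
    by apply: opnorm_le => x _; rewrite raddf0 normr0.
  by rewrite (le_trans (normr_ge0 (val (0 : clinear) 0))) // opnorm_ub ?normr0.
apply/eqP; rewrite eq_le opnormZ_le /= -ler_pdivlMl ?normr_gt0 //.
by rewrite -normfV -{1}(scalerK a0 f) opnormZ_le.
Qed.

HB.instance Definition _ := @Lmodule_isNormed.Build R clinear
  opnorm ler_opnormD opnormZ opnorm_eq0.

End ContinuousLinear.

(* Main.v *)
(* Let E(L, e, d) be the set of the points x at which L approximates f along V1
   up to e |v| for all v in V1 with |v| < d.  When L ranges over a countable
   dense subset of the operators from V1 to Y and e, d over the numbers 1/n, the
   boundaries of the closures of these sets form a first category set A.  If f
   is differentiable along V1 at x, then x lies in some E(L, e, d) with L close
   to the partial differential; outside A it is then interior to the closure of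
   E(L, e, d), and by continuity of f the approximation along V1 holds at all
   points near x, with the same L, e and d.  Writing
   f(x + v1 + v2) - f(x) as (f(x + v2 + v1) - f(x + v2)) + (f(x + v2) - f(x)),
   the first difference is controlled by this uniformity at x + v2, the second
   one by the differentiability of f at x along V2. *)
From HB Require Import structures.
Require Import Defs.
From mathcomp Require Import all_boot all_order all_algebra.
From mathcomp Require Import all_classical all_reals all_analysis.
From mathcomp Require Import lra.
Set Implicit Arguments.
Unset Strict Implicit.
Unset Printing Implicit Defensive.
Import Order.TTheory GRing.Theory Num.Theory.
Import numFieldNormedType.Exports.
Local Open Scope classical_set_scope.
Local Open Scope ring_scope.

Lemma nowhere_denseS (T : topologicalType) (A B : set T) :
  A `<=` B -> nowhere_dense B -> nowhere_dense A.
Proof.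
by move=> AB B0; rewrite /nowhere_dense -subset0 -B0; exact/interiorS/closureS.
Qed.

(** The difference is closed, so an interior point would have a neighborhood inside [closure E] and
    thus lie in the removed set [interior (closure E)]. *)
Lemma nowhere_dense_boundary (T : topologicalType) (E : set T) :
  nowhere_dense (closure E `\` interior (closure E)).
Proof.
have cE : closed (closure E `\` interior (closure E)).
  apply: closedI; first exact: closed_closure.
  by apply: open_closedC; exact: open_interior.
rewrite /nowhere_dense -(closure_id _).1 // -subset0 => p /[dup] pS.
move=> /interior_subset[_]; apply; apply: filterS pS.
by move=> q [].
Qed.

Lemma differentiable_bound (R : realType) (V W : normedModType R)
    (f : V -> W) (x : V) : differentiable f x ->
  forall e, 0 < e ->
    \forall h \near (0 : V), `|f (x + h) - f x - 'd f x h| <= e * `|h|.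
Proof.
move=> /diff_locallyP[_ /eqaddoP fx] e e0.
have := fx e e0; rewrite /= => {fx}; apply: filterS => h /=.
by rewrite -[X in `|X| <= _]/(f (h + x) - (f x + 'd f x h)) opprD addrA addrC
  [h + x]addrC [- 'd f x h + _]addrC.
Qed.

(** The estimate is the first order expansion with [df]; uniqueness of the differential turns it
    into the expansion with ['d f x]. *)
Lemma bound_differentiable (R : realType) (V W : normedModType R)
    (f : V -> W) (x : V) (df : {linear V -> W}) : continuous df ->
  (forall e, 0 < e ->
    \forall h \near (0 : V), `|f (x + h) - f x - df h| <= e * `|h|) ->
  differentiable f x.
Proof.
move=> dfc dfb.
have fE : f \o shift x = cst (f x) + df +o_ 0 id.
  apply/eqaddoP => e e0; apply: filterS (dfb e e0) => h /=.
  by rewrite -[X in _ -> `|X| <= _]/(f (h + x) - (f x + df h)) opprD addrA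
    [h + x]addrC.
by apply/diff_locallyP; rewrite (diff_unique dfc fE).
Qed.

Lemma opnorm_bound (R : realType) (V W : normedModType R) (f : clinear V W) x :
  `|val f x| <= `|f| * `|x|.
Proof.
have /asboolP[fl _] := valP f.
have f0 : val f 0 = 0.
  by have := fl (-1) 0 0; rewrite scaler0 addr0 scaleN1r addNr.
have fZ a u : val f (a *: u) = a *: val f u.
  by have := fl a u 0; rewrite addr0 f0 addr0.
have [->|x0] := eqVneq x 0; first by rewrite f0 !normr0 mulr0.
have := @opnorm_ub _ _ _ f (`|x|^-1 *: x).
rewrite normfZV // => /(_ (lexx _)).
by rewrite fZ normrZ normfV normr_id mulrC ler_pdivrMr ?normr_gt0.
Qed.

Lemma topological_complement_proj (R : realType) (X : normedModType R)
    (V1 V2 : closedSubspace X) : topological_complement V1 V2 ->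
  exists (p1 : {linear X -> V1}) (p2 : {linear X -> V2}),
    [/\ continuous p1, continuous p2 &
        forall x, x = val (p1 x) + val (p2 x)].
Proof.
move=> [g [sg gs gc]].
(* [g] is linear as the inverse of the linear sum map. *)
have gl : linear g.
  move=> a x y; apply: (can_inj sg); rewrite gs.
  rewrite -[RHS]/(val (a *: (g x).1 + (g y).1) + val (a *: (g x).2 + (g y).2)).
  by rewrite !raddfD /= addrACA -scalerDr !gs.
have p1l : linear (fst \o g) by move=> a x y; rewrite /= gl.
have p2l : linear (snd \o g) by move=> a x y; rewrite /= gl.
pose p1m := GRing.isLinear.Build _ _ _ _ _ p1l.
pose p2m := GRing.isLinear.Build _ _ _ _ _ p2l.
pose p1 : {linear X -> V1} := HB.pack (fst \o g) p1m.
pose p2 : {linear X -> V2} := HB.pack (snd \o g) p2m.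
exists p1, p2; split=> [x|x|x] /=.
- by apply: continuous_comp (gc x) _; exact: cvg_fst.
- by apply: continuous_comp (gc x) _; exact: cvg_snd.
- by rewrite gs.
Qed.

Lemma continuous_linear_bound (R : realType) (V W : normedModType R)
    (f : {linear V -> W}) : continuous f ->
  exists2 M, 0 < M & forall x, `|f x| <= M * `|x|.
Proof.
by move=> /linear_bounded_continuous/linear_boundedP/pinfty_ex_gt0.
Qed.

Section UniformApproximation.
Context {R : realType} {X Y : normedModType R} (f : X -> Y).
Context {V : closedSubspace X}.

Definition uniformly_approximated (L : V -> Y) (e d : R) : set X :=
  [set x | forall v : V, `|v| < d ->
    `|f (x + val v) - f x - L v| <= e * `|v|].

(** For fixed [v] the inequality passes to limits of base points, and [|v| < d] does not involve the
    base point. Continuity is asked at two points only, because [f] will be continuous only on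
    [G]. *)
Lemma closure_uniformly_approximated (L : V -> Y) e d x (v : V) :
  closure (uniformly_approximated L e d) x -> `|v| < d ->
  {for x, continuous f} -> {for x + val v, continuous f} ->
  `|f (x + val v) - f x - L v| <= e * `|v|.
Proof.
move=> Ex vd fx fxv; rewrite leNgt; apply/negP => lt.
have : (fun y => `|f (y + val v) - f y - L v|) @ x -->
    `|f (x + val v) - f x - L v|.
  apply: cvg_norm; apply: cvgB; last exact: cvg_cst.
  apply: cvgB fx.
  apply: (@continuous_comp _ _ _ (fun y => y + val v) f) fxv.
  by apply: cvgD; [exact: cvg_id|exact: cvg_cst].
move=> /cvgr_gt/(_ _ lt) /Ex [y [/(_ v vd)]] /=.
by rewrite leNgt => /negP.
Qed.

End UniformApproximation.

Lemma exists_natSinv_lt (R : realType) (e : R) : 0 < e ->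
  exists n : nat, n.+1%:R^-1 < e.
Proof.
move=> e0; have [n _ /(_ n (leqnn n)) ne] := near_infty_natSinv_lt (PosNum e0).
by exists n.
Qed.

Lemma countable_range_cover (T : Type) (x0 : T) (D : set T) : countable D ->
  exists u : nat -> T, D `<=` range u.
Proof.
(* The constant sequence [x0] serves when [D] is empty. *)
move=> /pfcard_geP[->|[u]]; first by exists (fun=> x0).
by exists u; have := @surj _ _ _ _ u.
Qed.

Unset Implicit Arguments.

Theorem proposition4p8 (R : realType) (X Y : completeNormedModType R)
    (X_neq0 : exists x : X, x != 0) (Y_neq0 : exists y : Y, y != 0)
    (G : set X) (G_open : open G)
    (f : X -> Y) (f_continuous : {within G, continuous f})
    (V1 : closedSubspace X) (V1Y_separable : separable_space (clinear V1 Y)) :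
  exists A : set X, [/\ A `<=` G, first_category A &
    forall x, (G `\` A) x ->
      differentiable_along f x V1 ->
      (exists V2 : closedSubspace X,
        topological_complement V1 V2 /\ differentiable_along f x V2) ->
      differentiable f x].
Proof.
have fc x : G x -> {for x, continuous f}.
  move=> Gx; move: f_continuous; rewrite continuous_open_subspace//.
  by apply; rewrite inE.
have [D /(countable_range_cover 0)[u Du] Dd] := V1Y_separable.
pose E i n m : set X :=
  uniformly_approximated f (val (u i)) n.+1%:R^-1 m.+1%:R^-1.
(* One sequence enumerates all triples; a code of no triple gives the empty set. Intersecting with
   [G] keeps the union inside [G]. *)
pose F k : set X := if unpickle k is Some (i, n, m) then
  G `&` (closure (E i n m) `\` interior (closure (E i n m))) else set0.
exists (\bigcup_k F k); split.
- move=> x [k _]; rewrite /F.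
  by case: (unpickle k) => [[[i n] m] []|].
- exists F => // k; rewrite /F; case: (unpickle k) => [[[i n] m]|].
    exact: nowhere_denseS (@subIsetr _ _ _) (nowhere_dense_boundary _).
  by rewrite /nowhere_dense closure0 interior0.
move=> x [Gx nAx] d1 [V2 [V12 d2]].
have [p1 [p2 [p1c p2c pE]]] := topological_complement_proj V12.
have [M1 M10 p1M] := continuous_linear_bound p1c.
have [M2 M20 p2M] := continuous_linear_bound p2c.
set g1 := fun v : V1 => f (x + val v) in d1.
set g2 := fun v : V2 => f (x + val v) in d2.
have df1c : continuous ('d g1 0) by exact: diff_continuous.
have df2c : continuous ('d g2 0) by exact: diff_continuous.
apply: (bound_differentiable (df := ('d g1 0 \o p1) \+ ('d g2 0 \o p2))).
  move=> h; apply: cvgD.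
    exact: continuous_comp (p1c h) (df1c _).
  exact: continuous_comp (p2c h) (df2c _).
move=> e e0.
(* The total error will be at most [c * (3/2 * M1 + M2) * |h|]; rounding 3/2 up to 2 gives this
   constant. *)
have K0 : 0 < 2 * M1 + M2 by rewrite addr_gt0 ?mulr_gt0.
have [n nK] := exists_natSinv_lt (divr_gt0 e0 K0).
set c := n.+1%:R^-1 in nK.
have c0 : 0 < c by rewrite invr_gt0.
have c20 : 0 < c / 2 by rewrite divr_gt0.
have L1P : ('d g1 0 : V1 -> Y) \in @clinear_pred R V1 Y.
  by apply/asboolP; split=> // a v w; rewrite linearP.
pose L1 : clinear V1 Y := exist (fun h => h \in @clinear_pred R V1 Y) _ L1P.
(* Half of [c] pays for replacing [L1] by a member of the dense sequence, the other half for the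
   remainder of [f] along [V1] at [x]. *)
have [L [L1L /Du[i _ uiL]]] : ball L1 (c / 2) `&` D !=set0.
  by apply: Dd; [exists L1; exact: ballxx|exact: ball_open].
have L1uE v : `|'d g1 0 v - val (u i) v| <= c / 2 * `|v|.
  have := opnorm_bound (L1 - L) v; rewrite -uiL => /le_trans; apply.
  by rewrite ler_wpM2r // uiL ltW // -ball_normE.
have /nbhs_norm0P[r /= r0 g1r] := differentiable_bound d1 c20.
have [m mr] := exists_natSinv_lt r0.
have Ex : closure (E i n m) x.
  apply: subset_closure => v vm.
  have /g1r := lt_trans vm mr.
  rewrite /g1 add0r addr0 -/g1 => g1v.
  rewrite -/c [c]splitr mulrDl.
  rewrite -(subrK ('d g1 0 v) (f _ - f x)) -addrA.
  by rewrite (le_trans (ler_normD _ _)) // lerD.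
(* Otherwise [x] would lie in the boundary set coded by [(i, n, m)], hence in the exceptional
   set. *)
have iEx : interior (closure (E i n m)) x.
  apply: contrapT => niEx; apply: nAx.
  by exists (pickle (i, n, m)) => //; rewrite /F pickleK.
have p10 : p1 h @[h --> 0] --> (0 : V1) by rewrite -(linear0 p1); exact: p1c.
have p20 : p2 h @[h --> 0] --> (0 : V2) by rewrite -(linear0 p2); exact: p2c.
have vp20 : x + val (p2 h) @[h --> 0] --> x.
  rewrite -[X in _ --> X]addr0; apply: cvgD; first exact: cvg_cst.
  apply/cvgr0Pnorm_lt => e' e'0.
  by move/cvgr0Pnorm_lt: p20 => /(_ _ e'0).
have m0 : 0 < m.+1%:R^-1 :> R by rewrite invr_gt0.
have g2c : \forall v \near (0 : V2),
    `|f (x + val v) - f x - 'd g2 0 v| <= c * `|v|.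
  apply: filterS (differentiable_bound d2 c0) => v.
  by rewrite add0r /g2 addr0.
near=> h.
have vE : x + h = x + val (p2 h) + val (p1 h).
  by rewrite {1}[h]pE addrA addrAC.
have step1 : `|f (x + val (p2 h) + val (p1 h)) - f (x + val (p2 h))
              - val (u i) (p1 h)| <= c * `|p1 h|.
  (* For small [h] the base point [x + val (p2 h)] stays in the interior of the closure, and both it
     and [x + h] stay in [G]. *)
  apply: closure_uniformly_approximated.
  - by near: h; apply: vp20; exact: iEx.
  - by near: h; move/cvgr0Pnorm_lt: p10 => /(_ _ m0).
  - by apply: fc; near: h; apply: vp20; exact: open_nbhs_nbhs.
  - rewrite -vE; apply: fc; near: h.
    have : x + h @[h --> 0] --> x.
      rewrite -[X in _ --> X]addr0.
      by apply: cvgD; [exact: cvg_cst|exact: cvg_id].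
    by apply; exact: open_nbhs_nbhs.
have step2 : `|f (x + val (p2 h)) - f x - 'd g2 0 (p2 h)| <= c * `|p2 h|.
  by near: h; exact: (p20 _ g2c).
rewrite vE /=.
have -> : f (x + val (p2 h) + val (p1 h)) - f x
    - ('d g1 0 (p1 h) + 'd g2 0 (p2 h)) =
  (f (x + val (p2 h) + val (p1 h)) - f (x + val (p2 h)) - val (u i) (p1 h))
  - ('d g1 0 (p1 h) - val (u i) (p1 h))
  + (f (x + val (p2 h)) - f x - 'd g2 0 (p2 h)).
  by rewrite opprB subrKA addrACA subrKA opprD.
rewrite (le_trans (ler_normD _ _)) // (le_trans (lerD (ler_normB _ _) step2)) //.
rewrite (le_trans (lerD (lerD step1 (L1uE _)) (lexx _))) //.
have cK : c * (2 * M1 + M2) <= e by rewrite -ler_pdivlMr // ltW.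
have := ler_wpM2r (normr_ge0 h) cK; apply: le_trans.
have := ler_wpM2l (ltW c0) (p1M h).
have := ler_wpM2l (ltW c0) (p2M h).
(* This nonnegative term covers the slack between 3/2 and 2. *)
have := mulr_ge0 (ltW c0) (mulr_ge0 (ltW M10) (normr_ge0 h)).
lra.
Unshelve. all: by end_near.
Qed.
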